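(* Let $\boldsymbol{k}$ be a (nonempty) index and $m$ a non-negative integer. Then, in $\mathcal{A}$, \[ \zeta_{\mathcal{A}}^{}(\boldsymbol{k} \ \underline{\ast} \ (\{1\}^m)^{\star})=(-1)^{\mathrm{dep}(\boldsymbol{k})}\sum_{\substack{\boldsymbol{l}\in\mathbb{Z}_{\geq 0}^{\mathrm{dep}(\boldsymbol{k})} \\ \mathrm{wt}(\boldsymbol{l})=m}}\ \sum_{\boldsymbol{l} \oplus\boldsymbol{k}\preceq\boldsymbol{h}\preceq\boldsymbol{l}\oslash\boldsymbol{k}}\zeta_{\mathcal{A}}^{}(\boldsymbol{h}), \] where for $m=0$ the left-hand side is interpreted as $\zeta_{\mathcal{A}}^{}(\boldsymbol{k})$.
   Context: An index is a tuple of positive integers; $\mathrm{dep}$ = length; for a tuple $\boldsymbol{l}=(l_1,\dots,l_r)$ of non-negative integers, $\mathrm{wt}(\boldsymbol{l})=l_1+\cdots+l_r$. For $\boldsymbol{k}=(k_1,\dots,k_r)$: $\zeta_{<N}(\boldsymbol{k})\coloneqq\sum_{0<n_1<\cdots<n_r<N}n_1^{-k_1}\cdots n_r^{-k_r}$. Let $\mathcal{P}$ be the set of primes and $\mathcal{A}\coloneqq\bigl(\prod_{p\in\mathcal{P}}\mathbb{Z}/p\mathbb{Z}\bigr)/\bigl(\bigoplus_{p\in\mathcal{P}}\mathbb{Z}/p\mathbb{Z}\bigr)$; $\zeta_{\mathcal{A}}(\boldsymbol{k})\coloneqq(\zeta_{<p}(\boldsymbol{k})\bmod p)_{p}\in\mathcal{A}$.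 Let $\mathcal{R}$ be the $\mathbb{Q}$-vector space of formal linear combinations of indices; $\zeta_{<N}$, $\zeta_{\mathcal{A}}$ are extended $\mathbb{Q}$-linearly to $\mathcal{R}$. $\boldsymbol{l}\preceq\boldsymbol{k}$ means $\boldsymbol{l}$ is obtained from $\boldsymbol{k}$ by replacing some (possibly none) commas by plus signs; $\boldsymbol{k}^\star\coloneqq\sum_{\boldsymbol{h}\preceq\boldsymbol{k}}\boldsymbol{h}\in\mathcal{R}$. For $\boldsymbol{l}\in\mathbb{Z}_{\ge0}^r$ and $\boldsymbol{k}=(k_1,\dots,k_r)$: $\boldsymbol{l}\oplus\boldsymbol{k}\coloneqq(l_1+k_1,\dots,l_r+k_r)$ and $\boldsymbol{l}\oslash\boldsymbol{k}\coloneqq(l_1+1,\{1\}^{k_1-1},\dots,l_r+1,\{1\}^{k_r-1})$, where $\{1\}^n$ is $n$ repeated 1's. $\ast$ is the harmonic (stuffle) product on $\mathcal{R}$: bilinear, the empty index is the unit, and $(\boldsymbol{a},a)\ast(\boldsymbol{b},b)=((\boldsymbol{a}\ast(\boldsymbol{b},b)),a)+(((\boldsymbol{a},a)\ast\boldsymbol{b}),b)+((\boldsymbol{a}\ast\boldsymbol{b}),a+b)$ (appending an entry is extended linearly); it satisfies $\zeta_{<N}(\boldsymbol{k})\zeta_{<N}(\boldsymbol{l})=\zeta_{<N}(\boldsymbol{k}\ast\boldsymbol{l})$. The bilinear map $\underline{\ast}$ on nonempty indices is $\boldsymbol{k}\ \underline{\ast}\ \boldsymbol{l}\coloneqq((\boldsymbol{k}_-\ast\boldsymbol{l}),k)+((\boldsymbol{k}_-\ast\boldsymbol{l}_-),k+l)$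 for $\boldsymbol{k}=(\boldsymbol{k}_-,k)$, $\boldsymbol{l}=(\boldsymbol{l}_-,l)$, extended linearly. *)

(* Defs.v *)
From HB Require Import structures.
From mathcomp Require Import all_boot all_order all_algebra.
From mathcomp Require Import mathcomp_extra boolp classical_sets functions cardinality.
From mathcomp Require Import ring.
From mathcomp.multinomials Require Import freeg.

Set Implicit Arguments.
Unset Strict Implicit.
Unset Printing Implicit Defensive.

Import GRing.Theory Num.Theory.

Local Open Scope ring_scope.
Local Open Scope quotient_scope.

Definition primeT := {p : nat | prime p}.

Definition prodFp := forall p : primeT, 'F_(val p).

HB.instance Definition _ := gen_eqMixin prodFp.
HB.instance Definition _ := gen_choiceMixin prodFp.

Section ProdFp.
Implicit Types x y z : prodFp.

Definition prodFp_zero : prodFp := fun=> 0.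
Definition prodFp_one : prodFp := fun=> 1.
Definition prodFp_opp x : prodFp := fun p => - x p.
Definition prodFp_add x y : prodFp := fun p => x p + y p.
Definition prodFp_mul x y : prodFp := fun p => x p * y p.

Lemma prodFpP x y : (forall p, x p = y p) -> x = y.
Proof. exact: functional_extensionality_dep. Qed.

Lemma prodFp_addA : associative prodFp_add.
Proof. by move=> x y z; apply: prodFpP => p; rewrite /prodFp_add addrA. Qed.
Lemma prodFp_addC : commutative prodFp_add.
Proof. by move=> x y; apply: prodFpP => p; rewrite /prodFp_add addrC. Qed.
Lemma prodFp_add0 : left_id prodFp_zero prodFp_add.
Proof. by move=> x; apply: prodFpP => p; rewrite /prodFp_add add0r. Qed.
Lemma prodFp_addN : left_inverse prodFp_zero prodFp_opp prodFp_add.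
Proof. by move=> x; apply: prodFpP => p; rewrite /prodFp_add addNr. Qed.

HB.instance Definition _ :=
  GRing.isZmodule.Build prodFp prodFp_addA prodFp_addC prodFp_add0 prodFp_addN.

Lemma prodFp_mulA : associative prodFp_mul.
Proof. by move=> x y z; apply: prodFpP => p; rewrite /prodFp_mul mulrA. Qed.
Lemma prodFp_mulC : commutative prodFp_mul.
Proof. by move=> x y; apply: prodFpP => p; rewrite /prodFp_mul mulrC. Qed.
Lemma prodFp_mul1 : left_id prodFp_one prodFp_mul.
Proof. by move=> x; apply: prodFpP => p; rewrite /prodFp_mul mul1r. Qed.
Lemma prodFp_mulDl : left_distributive prodFp_mul +%R.
Proof. by move=> x y z; apply: prodFpP => p; rewrite /prodFp_mul mulrDl. Qed.
Lemma prodFp_oner_neq0 : prodFp_one != 0.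
Proof.
apply/eqP => /(congr1 (fun x : prodFp => x (exist _ 2%N isT))) /eqP.
by rewrite oner_eq0.
Qed.

HB.instance Definition _ := GRing.Zmodule_isComNzRing.Build prodFp
  prodFp_mulA prodFp_mulC prodFp_mul1 prodFp_mulDl prodFp_oner_neq0.

Lemma prodFp0E p : (0 : prodFp) p = 0. Proof. by []. Qed.
Lemma prodFp1E p : (1 : prodFp) p = 1. Proof. by []. Qed.
Lemma prodFpDE x y p : (x + y) p = x p + y p. Proof. by []. Qed.
Lemma prodFpNE x p : (- x) p = - x p. Proof. by []. Qed.
Lemma prodFpBE x y p : (x - y) p = x p - y p. Proof. by []. Qed.
Lemma prodFpME x y p : (x * y) p = x p * y p. Proof. by []. Qed.

End ProdFp.

Definition sumFp (x : prodFp) : bool :=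
  `[< finite_set [set p : primeT | x p != 0]%classic >].

Lemma infinite_primeT : infinite_set [set: primeT]%classic.
Proof.
move=> fT.
have /finite_seqP[s sE] : finite_set (val @` [set: primeT])%classic.
  exact: finite_image.
have [p ltp pp] := prime_above (\max_(q <- s) q)%N.
have : (p \in s).
  have : (val @` [set: primeT])%classic p by exists (exist _ p pp).
  by rewrite sE.
by move=> ps; have := @leq_bigmax_seq _ s xpredT (fun q => q) p ps isT; rewrite leqNgt ltp.
Qed.

Lemma sumFp_idealr : idealr_closed sumFp.
Proof.
split=> [||a x y].
- apply/asboolP; apply: sub_finite_set (finite_set0 _) => p.
  by move=> /eqP[].
- apply/asboolP => f1; apply: infinite_primeT; apply: sub_finite_set f1 => p _.
  exact: (oner_neq0 'F_(val p)).
- move=> /asboolP fx /asboolP fy; apply/asboolP.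
  have : finite_set ([set p : primeT | x p != 0] `|`
                     [set p : primeT | y p != 0])%classic by rewrite finite_setU.
  apply: sub_finite_set => p /=; rewrite prodFpDE prodFpME => axy.
  have [x0|] := eqVneq (x p) 0; last by left.
  by right; apply: contra_neq axy => ->; rewrite x0 mulr0 addr0.
Qed.

HB.instance Definition _ := isIdealr.Build prodFp sumFp sumFp_idealr.

Definition sumFp_ideal : idealr prodFp := sumFp.

Definition calA := {ideal_quot sumFp_ideal}.

HB.instance Definition _ := GRing.ComNzRing.on calA.

Definition toA (x : prodFp) : calA := \pi_calA x.

Lemma toAP x y :
  toA x = toA y <-> finite_set [set p : primeT | x p != y p]%classic.
Proof.
have E : [set p : primeT | x p != y p]%classic =
         [set p : primeT | (x - y) p != 0]%classic.
  by apply/seteqP; split=> p /=; rewrite prodFpBE subr_eq0.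
rewrite E /toA; split.
  by move/eqP; rewrite -Quotient.idealrBE => /asboolP.
by move=> fxy; apply/eqP; rewrite -Quotient.idealrBE; apply/asboolP.
Qed.

Lemma toAD x y : toA (x + y) = toA x + toA y.
Proof. exact: (rmorphD (\pi_({ideal_quot sumFp_ideal}))). Qed.
Lemma toAM x y : toA (x * y) = toA x * toA y.
Proof. exact: (rmorphM (\pi_({ideal_quot sumFp_ideal}))). Qed.
Lemma toA1 : toA 1 = 1.
Proof. exact: (rmorph1 (\pi_({ideal_quot sumFp_ideal}))). Qed.

(* [ratr r : 'F_p] is the reduction of [r] mod p when p does not divide the   *)
(* denominator of [r]; its value at the finitely many other primes is junk,   *)
(* which is invisible in [calA].                                              *)
Definition ratA (r : rat) : calA := toA (fun p => ratr r).

Lemma finite_prime_int (n : int) : n != 0 ->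
  finite_set [set p : primeT | n%:~R == 0 :> 'F_(val p)]%classic.
Proof.
move=> n0.
have : finite_set (val @^-1` `I_(`|n|%N.+1) : set primeT)%classic.
  by apply: finite_preimage; [move=> ? ? _ _; apply: val_inj | exact: finite_II].
apply: sub_finite_set => -[p pp] /=; rewrite ltnS => /eqP np0.
apply: dvdn_leq; first by rewrite absz_gt0.
rewrite (dvdn_pcharf (pchar_Fp pp)).
by case: (intP n) np0 => [|m|m] //= /eqP; rewrite ?NegzE ?abszN ?mulrNz ?oppr_eq0.
Qed.

Lemma ratr_frac (F : fieldType) (r : rat) (x y : int) :
  r * y%:~R = x%:~R -> y%:~R != 0 :> F -> (denq r)%:~R != 0 :> F ->
  ratr r = x%:~R / y%:~R :> F.
Proof.
move=> rxy y0 d0; apply/eqP; rewrite /ratr eqr_div // -!intrM; apply/eqP.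
congr (_%:~R); apply: (@intr_inj rat); rewrite !intrM -rxy.
by rewrite numqE mulrAC.
Qed.

Lemma ratA_eq (x y : prodFp) (n : int) : n != 0 ->
  (forall p : primeT, n%:~R != 0 :> 'F_(val p) -> x p = y p) -> toA x = toA y.
Proof.
move=> n0 xy; apply/toAP; apply: sub_finite_set (finite_prime_int n0) => p /=.
by apply: contraNT => /xy ->.
Qed.

Lemma ratAD r s : ratA (r + s) = ratA r + ratA s.
Proof.
rewrite -toAD; apply: (@ratA_eq _ _ (denq r * denq s * denq (r + s))).
  by rewrite !mulf_neq0.
move=> p; rewrite !intrM !mulf_eq0 !negb_or => /andP[/andP[r0 s0] rs0].
rewrite prodFpDE.
rewrite (@ratr_frac _ (r + s) (numq r * denq s + numq s * denq r)
                               (denq r * denq s)) //.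
- by rewrite /ratr addf_div // intrD !intrM.
- by rewrite intrD !intrM !numqE; ring.
- by rewrite intrM mulf_neq0.
Qed.

Lemma ratAM r s : ratA (r * s) = ratA r * ratA s.
Proof.
rewrite -toAM; apply: (@ratA_eq _ _ (denq r * denq s * denq (r * s))).
  by rewrite !mulf_neq0.
move=> p; rewrite !intrM !mulf_eq0 !negb_or => /andP[/andP[r0 s0] rs0].
rewrite prodFpME (@ratr_frac _ (r * s) (numq r * numq s) (denq r * denq s)) //.
- by rewrite /ratr mulf_div !intrM.
- by rewrite !intrM !numqE; ring.
- by rewrite intrM mulf_neq0.
Qed.

Lemma ratA1 : ratA 1 = 1.
Proof.
rewrite -toA1; congr toA; apply: prodFpP => p.
by rewrite prodFp1E /ratr /= divr1.
Qed.

Definition scaleA (r : rat) (x : calA) : calA := ratA r * x.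

Lemma scaleA_A r s x : scaleA r (scaleA s x) = scaleA (r * s) x.
Proof. by rewrite /scaleA ratAM mulrA. Qed.
Lemma scaleA_1 : left_id 1 scaleA.
Proof. by move=> x; rewrite /scaleA ratA1 mul1r. Qed.
Lemma scaleA_Dr : right_distributive scaleA +%R.
Proof. by move=> r x y; rewrite /scaleA mulrDr. Qed.
Lemma scaleA_Dl x : {morph scaleA^~ x : r s / r + s}.
Proof. by move=> r s; rewrite /scaleA ratAD mulrDl. Qed.

HB.instance Definition _ := GRing.Zmodule_isLmodule.Build rat calA
  scaleA_A scaleA_1 scaleA_Dr scaleA_Dl.

Lemma scaleAE (r : rat) (x : calA) : r *: x = ratA r * x.
Proof. by []. Qed.

Definition posnat := {n : nat | (0 < n)%N}.
HB.instance Definition _ := Choice.on posnat.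

Definition one_pos : posnat := exist _ 1%N isT.

Lemma addpos_subproof (l : nat) (k : posnat) : (0 < l + val k)%N.
Proof. by rewrite addn_gt0 (valP k) orbT. Qed.

Definition addpos (l : nat) (k : posnat) : posnat :=
  exist _ (l + val k)%N (addpos_subproof l k).

Definition idx := seq posnat.
HB.instance Definition _ := Choice.on idx.

Notation dep k := (size (k : idx)).

Definition calR := {freeg idx / rat}.
HB.instance Definition _ := GRing.Lmodule.on calR.

Definition of_idx (k : idx) : calR := << k >>.

(* Multiple harmonic sums; [path ltn 0] says 0 < n_1 < ... < n_r.             *)
Definition zeta_lt (N : nat) (k : idx) : rat :=
  \sum_(n : (dep k).-tuple 'I_N | path ltn 0%N [seq val i | i <- n])
    \prod_(i < dep k)
      ((val (tnth n i))%:R : rat) ^- val (tnth (in_tuple k) i).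

(* The denominator of zeta_{<p}(k) is prime to p, so [ratr] is reduction      *)
(* mod p at every prime p.                                                    *)
Definition zeta_A_idx (k : idx) : calA :=
  toA (fun p => ratr (zeta_lt (val p) k)).

Definition zeta_A (u : calR) : calA := fglift zeta_A_idx u.

(* All ways of replacing some commas of the tuple (x, s) by plus signs.       *)
Fixpoint merges (x : posnat) (s : idx) : seq idx :=
  if s is y :: s' then
    [seq x :: h | h <- merges y s'] ++ merges (addpos (val x) y) s'
  else [:: [:: x]].

Definition coarsenings (k : idx) : seq idx :=
  undup (if k is x :: s then merges x s else [:: [::]]).

Definition preceq (l k : idx) : bool := l \in coarsenings k.

Definition star (k : idx) : calR := \sum_(h <- coarsenings k) of_idx h.

(* [oplus] and [oslash] are used with l and k of the same length.             *)
Definition oplus (l : seq nat) (k : idx) : idx :=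
  [seq addpos p.1 p.2 | p <- zip l k].

Definition oslash (l : seq nat) (k : idx) : idx :=
  flatten [seq addpos p.1 one_pos :: nseq (val p.2).-1 one_pos | p <- zip l k].

Definition append (u : calR) (a : posnat) : calR :=
  fglift (fun k => of_idx (rcons k a)) u.

(* The recursion is on last entries, hence the arguments are reversed.        *)
Fixpoint stuffle_rev (s t : seq posnat) {struct s} : calR :=
  (fix aux (t : seq posnat) : calR :=
     match s, t with
     | [::], _ => of_idx (rev t)
     | _, [::] => of_idx (rev s)
     | a :: s', b :: t' =>
         append (stuffle_rev s' t) a + append (aux t') b
         + append (stuffle_rev s' t') (addpos (val a) b)
     end) t.

Definition stuffle (k l : idx) : calR := stuffle_rev (rev k) (rev l).

Lemma stuffle0l l : stuffle [::] l = of_idx l.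
Proof. by rewrite /stuffle -[in RHS](revK l); case: (rev l). Qed.

Lemma stuffle0r k : stuffle k [::] = of_idx k.
Proof. by rewrite /stuffle -[in RHS](revK k); case: (rev k). Qed.

Lemma stuffle_rcons k a l b :
  stuffle (rcons k a) (rcons l b) =
    append (stuffle k (rcons l b)) a + append (stuffle (rcons k a) l) b
    + append (stuffle k l) (addpos (val a) b).
Proof. by rewrite /stuffle !rev_rcons. Qed.

(* The value 0 when k or l is empty is junk.                                  *)
Definition ustuffle_idx (k l : idx) : calR :=
  match rev k, rev l with
  | a :: k', b :: l' =>
      append (stuffle (rev k') l) a
      + append (stuffle (rev k') (rev l')) (addpos (val a) b)
  | _, _ => 0
  end.

Definition ustuffle (u v : calR) : calR :=
  fglift (fun k => fglift (ustuffle_idx k) v) u.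

Lemma ustuffle_idx_rcons k a l b :
  ustuffle_idx (rcons k a) (rcons l b) =
    append (stuffle k (rcons l b)) a
    + append (stuffle k l) (addpos (val a) b).
Proof. by rewrite /ustuffle_idx !rev_rcons !revK. Qed.

Lemma zeta_A_of_idx k : zeta_A (of_idx k) = zeta_A_idx k.
Proof. by rewrite /zeta_A /of_idx liftU scale1r. Qed.

Lemma ustuffle_of_idx k l : ustuffle (of_idx k) (of_idx l) = ustuffle_idx k l.
Proof. by rewrite /ustuffle /of_idx !liftU !scale1r. Qed.

(* Main.v *)
(* Everything happens in 'F_p for one prime p.  Put
     S_m(n) = sum of 1/(n_1 ... n_m) over 1 <= n_1 <= ... <= n_m <= n,
     C_m(n, b) = (-1)^n 'C(b, n) S_m(n).
   The left-hand side is the nested sum over n_1 < ... < n_r < p of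
   n_1^-k_1 ... n_r^-k_r S_m(n_r), and S_m(n) = C_m(n, p - 1) in 'F_p.  Starting
   from this connected sum, each factor 1/n_r but the last is moved to the other
   side of the connector by
     C_m(n, B) / n = sum_{b <= B} C_m(n, b) / b,
   and the last one by
     sum_{a < n < p} C_m(n, b) / b = - sum_{l <= m} b^-(l+1) C_{m-l}(a, b - 1),
   which consumes n_r, hence one sign per entry of k.  What remains is a nested
   sum over the entries of l oslash k with strict inequalities between blocks and
   weak ones inside them; splitting each weak inequality into a strict one and an
   equality gives the indices h of the right-hand side. *)

Require Import Defs.
From mathcomp Require Import all_boot all_order all_algebra.
From mathcomp Require Import ring zify.
From mathcomp.multinomials Require Import freeg.

Import GRing.Theory.
Local Open Scope ring_scope.

(** * Nested harmonic sums over a field *)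

(* Nested sum over n_1, ..., n_r < N for the word w = (st_1, e_1) ... (st_r, e_r);
   st_j tells whether n_{j-1} < n_j or n_{j-1} <= n_j, where n_0 = c.
   The value n_j = 0 contributes nothing, since 0^-1 = 0 and e_j > 0. *)
Fixpoint mhs (F : fieldType) (c : nat) (w : seq (bool * posnat)) (N : nat) : F :=
  if w is x :: w' then
    \sum_(i < N | (c + x.1 <= i)%N) i%:R ^- val x.2 * mhs F i w' N
  else 1.

Definition strict (k : idx) : seq (bool * posnat) := [seq (true, x) | x <- k].

Definition zetaF (F : fieldType) (k : idx) (N : nat) : F := mhs F 0 (strict k) N.

(** [mhs] peels off the first letter, whereas the transport consumes the last one. The bound
    [n.+1 - x.1] is [n] for a strict last inequality and [n.+1] for a weak one. *)
Lemma mhs_rcons (F : fieldType) c w x N :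
  mhs F c (rcons w x) N =
    \sum_(n < N | (c + x.1 <= n)%N) n%:R ^- val x.2 * mhs F c w (n.+1 - x.1).
Proof.
case: x => st e /=; elim: w c => [|[st' e'] w IH] c /=.
  by apply: eq_bigr => i _; rewrite mulr1.
under eq_bigr => i _ do rewrite IH big_distrr /=.
rewrite (exchange_big_dep (fun n : 'I_N => (c + st <= n)%N)) /=; last first.
  move=> i n; case: (st) (st') => [] []  /=; lia.
apply: eq_bigr => n cn; rewrite big_distrr /=.
rewrite (big_ord_widen_cond N _ (fun i => n%:R ^- val e *
  (i%:R ^- val e' * mhs F i w (n.+1 - st)))) /=; last first.
  by have := ltn_ord n; case: (st) => /=; lia.
apply: eq_big => [i|i _]; last by rewrite mulrCA.
by case: (st) (st') => [] [] /=; lia.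
Qed.

Lemma expf0N (F : fieldType) (e : posnat) : (0%:R : F) ^- val e = 0.
Proof. by rewrite expr0n; case: e => -[|e] //= _; rewrite invr0. Qed.

Lemma mhs0_rcons (F : fieldType) w st e N :
  mhs F 0 (rcons w (st, e)) N =
    \sum_(n < N) n%:R ^- val e * mhs F 0 w (n.+1 - st).
Proof.
rewrite mhs_rcons /= big_mkcond; apply: eq_bigr => i _.
by rewrite add0n; case: st => //=; case: (val i) => //=; rewrite expf0N mul0r.
Qed.

Lemma zetaF_rcons (F : fieldType) k a N :
  zetaF F (rcons k a) N = \sum_(n < N) n%:R ^- val a * zetaF F k n.
Proof.
rewrite /zetaF /strict map_rcons mhs0_rcons.
by apply: eq_bigr => i _; rewrite subSS subn0.
Qed.

Lemma natF_neq0 (F : fieldType) p n : p \in [pchar F] -> (0 < n < p)%N ->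
  n%:R != 0 :> F.
Proof.
move=> chF /andP[n0 np]; rewrite -(dvdn_pcharf chF).
by apply/negP => /(dvdn_leq n0); rewrite leqNgt np.
Qed.

(** * The sums [S_m(n)], the connector [C_m(n, b)] and its identities *)

Definition hsum1 (F : fieldType) (m n : nat) : F :=
  mhs F 0 (nseq m (false, one_pos)) n.+1.

Lemma hsum1S (F : fieldType) m n :
  hsum1 F m.+1 n = \sum_(j < n.+1) j%:R^-1 * hsum1 F m j.
Proof.
rewrite /hsum1 (_ : nseq m.+1 _ = rcons (nseq m (false, one_pos)) (false, one_pos)).
  by rewrite mhs0_rcons; apply: eq_bigr => j _; rewrite subn0.
by elim: m => //= m ->.
Qed.

Lemma hsum1S0 (F : fieldType) m : hsum1 F m.+1 0 = 0.
Proof. by rewrite hsum1S big_ord1 invr0 mul0r. Qed.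

Lemma hsum1SS (F : fieldType) m n :
  hsum1 F m.+1 n.+1 = hsum1 F m.+1 n + n.+1%:R^-1 * hsum1 F m n.+1.
Proof. by rewrite !hsum1S big_ord_recr /=. Qed.

Definition connector (F : fieldType) (m n b : nat) : F :=
  (-1) ^+ n * 'C(b, n)%:R * hsum1 F m n.

Lemma connector_gt (F : fieldType) m n b : (b < n)%N -> connector F m n b = 0.
Proof. by move=> bn; rewrite /connector bin_small // mulr0 mul0r. Qed.

(** Absorption: [(b + 1) 'C(b, n) = (n + 1) 'C(b + 1, n + 1)]. *)
Lemma bin_diag_inv (F : fieldType) p n b : p \in [pchar F] -> (b.+1 < p)%N ->
  b.+1%:R^-1 * 'C(b.+1, n.+1)%:R = n.+1%:R^-1 * 'C(b, n)%:R :> F.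
Proof.
(* For [b < n] both binomials vanish; there [n.+1] may be divisible by [p]. *)
move=> chF bp; have [bn|nb] := ltnP b n.
  by rewrite !bin_small ?mulr0 // ltnS.
have b0 : b.+1%:R != 0 :> F by apply: natF_neq0 chF _.
have n0 : n.+1%:R != 0 :> F by apply: natF_neq0 chF _; rewrite (leq_ltn_trans _ bp).
apply: (mulfI b0); rewrite mulrA mulfV // mul1r.
apply: (mulfI n0); rewrite -natrM -(mul_bin_diag b.+1) natrM.
by rewrite [RHS]mulrCA mulVKf.
Qed.

Lemma connector0_pascal (F : fieldType) n b :
  connector F 0 n.+1 b.+1 = connector F 0 n.+1 b - connector F 0 n b.
Proof. by rewrite /connector binS natrD exprS /hsum1 /=; ring. Qed.

(** Besides Pascal's rule, [S_{m+1}(n + 1) - S_{m+1}(n) = S_m(n + 1) / (n + 1)] enters; absorption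
    turns this [1 / (n + 1)] into [1 / (b + 1)]. *)
Lemma connectorS_pascal (F : fieldType) p m n b : p \in [pchar F] -> (b.+1 < p)%N ->
  connector F m.+1 n.+1 b.+1 =
    b.+1%:R^-1 * connector F m n.+1 b.+1 +
    (connector F m.+1 n.+1 b - connector F m.+1 n b).
Proof.
move=> chF bp; rewrite /connector.
have -> (x y : F) : b.+1%:R^-1 * (x * 'C(b.+1, n.+1)%:R * y) =
    x * (n.+1%:R^-1 * 'C(b, n)%:R) * y.
  by rewrite -(bin_diag_inv _ _ _ _ chF) //; ring.
by rewrite binS natrD exprS hsum1SS; ring.
Qed.

(** Induction on [m]: the differences in the Pascal rule telescope over [n] and give the term
    [l = 0]; for positive [m] the rest is [1 / (b + 1)] times the preceding case. *)
Lemma sum_connector (F : fieldType) p m a b : p \in [pchar F] ->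
  (a < p)%N -> (b.+1 < p)%N ->
  \sum_(a.+1 <= n < p) connector F m n b.+1 =
    - \sum_(l < m.+1) b.+1%:R ^- l * connector F (m - l) a b.
Proof.
move=> chF ap bp.
(* The upper endpoint [n = p - 1] contributes 0 because [b < p - 1]. *)
have tel m' : \sum_(a.+1 <= n < p) (connector F m' n b - connector F m' n.-1 b) =
    - connector F m' a b.
  rewrite big_add1 telescope_sumr; last by rewrite -ltnS prednK ?(leq_ltn_trans _ ap).
  by rewrite connector_gt ?sub0r //; case: (p) bp.
elim: m => [|m IH].
  rewrite big_ord1 expr0 invr1 mul1r -tel big_add1 [RHS]big_add1.
  by apply: eq_bigr => n _; rewrite connector0_pascal.
rewrite big_add1.
under eq_bigr => n _ do rewrite (connectorS_pascal _ _ _ _ _ chF) //.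
rewrite big_split /= -big_distrr /=.
have := tel m.+1; rewrite big_add1 /= => ->.
have := IH; rewrite big_add1 /= => ->.
rewrite [in RHS]big_ord_recl expr0 invr1 mul1r subn0 opprD addrC mulrN; congr (_ - _).
rewrite big_distrr /=; apply: eq_bigr => l _.
by rewrite /bump leq0n add1n subSS mulrA -invfM -exprS.
Qed.

(** Only the binomial depends on [b], and ['C(b, n) / b = 'C(b - 1, n - 1) / n] by absorption, so
    this is the hockey-stick identity. *)
Lemma connector_mulV (F : fieldType) p m n B : p \in [pchar F] ->
  (0 < n)%N -> (B < p)%N ->
  n%:R^-1 * connector F m n B = \sum_(b < B.+1) b%:R^-1 * connector F m n b.
Proof.
move=> chF; case: n => // n _; elim: B => [|B IH] Bp.
  by rewrite big_ord1 invr0 mul0r connector_gt // mulr0.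
rewrite big_ord_recr /= -IH ?(ltnW Bp) // /connector.
have -> (x y : F) : B.+1%:R^-1 * (x * 'C(B.+1, n.+1)%:R * y) =
    x * (n.+1%:R^-1 * 'C(B, n)%:R) * y.
  by rewrite -(bin_diag_inv _ _ _ _ chF) //; ring.
by rewrite binS natrD; ring.
Qed.

(* 'C(p - 1, n) = (-1)^n in characteristic p. *)
Lemma connector_top (F : fieldType) p m n : p \in [pchar F] -> (n < p)%N ->
  connector F m n p.-1 = hsum1 F m n.
Proof.
move=> chF np; rewrite /connector.
suff -> : 'C(p.-1, n)%:R = (-1) ^+ n :> F by rewrite -exprMn mulrNN mulr1 expr1n mul1r.
elim: n np => [|n IH] np; first by rewrite bin0.
have p0 : (0 < p)%N by apply: leq_ltn_trans np.
have : 'C(p, n.+1)%:R = 0 :> F.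
  apply/eqP; rewrite -(dvdn_pcharf chF) prime_dvd_bin ?(pcharf_prime chF) //.
rewrite -{1}(prednK p0) binS natrD (IH (ltnW np)) => /eqP.
by rewrite addr_eq0 => /eqP ->; rewrite exprS mulN1r.
Qed.

(** * Nested sums over blocks, one block per entry of [k] *)

Lemma sum_tuple_rcons (V : zmodType) (T : finType) r (P : pred (seq T))
    (f : seq T -> V) :
  \sum_(t : r.+1.-tuple T | P t) f t =
    \sum_(t : r.-tuple T) \sum_(x : T | P (rcons t x)) f (rcons t x).
Proof.
rewrite pair_big_dep /=.
pose h (q : r.-tuple T * T) : r.+1.-tuple T := [tuple of rcons q.1 q.2].
rewrite (reindex h) //; apply: onW_bij; apply: inj_card_bij.
  by move=> [t x] [t' x'] /(congr1 val) /rcons_inj[/val_inj -> ->].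
by rewrite card_prod !card_tuple expnSr.
Qed.

Definition block (l j : nat) : seq (bool * posnat) :=
  (true, addpos l one_pos) :: nseq j (false, one_pos).

Definition blocks (l : seq nat) (k : idx) : seq (bool * posnat) :=
  flatten [seq block q.1 (val q.2).-1 | q <- zip l k].

Lemma blocks_rcons l x k a : size l = size k ->
  blocks (rcons l x) (rcons k a) = blocks l k ++ block x (val a).-1.
Proof.
by move=> lk; rewrite /blocks zip_rcons // map_rcons flatten_rcons.
Qed.

(** The bound [M] on the entries is kept apart from the weight [m], so that the type of the tuples
    stays fixed while the transport lowers [m]. *)
Definition blocksum (F : fieldType) (M r m : nat) (k : idx) (N : nat) : F :=
  \sum_(l : r.-tuple 'I_M.+1 | sumn (map val l) == m)
    mhs F 0 (blocks (map val l) k) N.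

Definition tailsum (F : fieldType) (M r m : nat) (k : idx) (j N : nat) : F :=
  \sum_(l : r.-tuple 'I_M.+1)
    \sum_(x : 'I_M.+1 | (sumn (map val l) + x)%N == m)
      mhs F 0 (blocks (map val l) k ++ block x j) N.

Lemma blocksum_rcons (F : fieldType) M r m k a N : size k = r ->
  blocksum F M r.+1 m (rcons k a) N = tailsum F M r m k (val a).-1 N.
Proof.
move=> kr; rewrite /blocksum (sum_tuple_rcons _ _ _ (fun t => sumn (map val t) == m)
  (fun t => mhs F 0 (blocks (map val t) (rcons k a)) N)).
apply: eq_bigr => t _; apply: eq_big => [x|x _].
  by rewrite map_rcons sumn_rcons.
by rewrite map_rcons blocks_rcons // size_map size_tuple.
Qed.

Lemma tailsumS (F : fieldType) M r m k j N :
  tailsum F M r m k j.+1 N = \sum_(n < N) n%:R^-1 * tailsum F M r m k j n.+1.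
Proof.
under [RHS]eq_bigr => n _ do rewrite big_distrr /=.
rewrite exchange_big; apply: eq_bigr => t _.
under [RHS]eq_bigr => n _ do rewrite big_distrr /=.
rewrite exchange_big; apply: eq_bigr => x _.
have -> : blocks (map val t) k ++ block x j.+1 =
    rcons (blocks (map val t) k ++ block x j) (false, one_pos).
  rewrite rcons_cat; congr (_ ++ _ :: _).
  by elim: j => //= j <-.
by rewrite mhs0_rcons; apply: eq_bigr => n _; rewrite subn0.
Qed.

(** Taking off the one-letter last block [l.+1] leaves weight [m - l]. By [m <= M], every [l <= m]
    is an admissible entry. *)
Lemma tailsum0 (F : fieldType) M r m k N : (m <= M)%N ->
  tailsum F M r m k 0 N =
    \sum_(n < N) \sum_(l < m.+1) n%:R ^- l.+1 * blocksum F M r (m - l) k n.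
Proof.
move=> mM; rewrite /tailsum.
under eq_bigr => t _ do under eq_bigr => x _ do
  rewrite cats1 mhs0_rcons /= addn1.
rewrite (exchange_big_dep (fun x : 'I_M.+1 => (x < m.+1)%N)) /=; last first.
  by move=> t x _ /eqP <-; rewrite ltnS leq_addl.
rewrite exchange_big /=.
rewrite (big_ord_widen M.+1 (fun l =>
  \sum_(n < N) n%:R ^- l.+1 * blocksum F M r (m - l) k n)) //.
apply: eq_bigr => x xm; rewrite exchange_big /=; apply: eq_bigr => n _.
rewrite subSS subn0 big_distrr /=; apply: eq_bigl => t.
by rewrite -[RHS](eqn_add2r x) subnK.
Qed.

(** * Transport of the connected sum *)

(** After exchanging the sums, [sum_connector] evaluates the inner sum over [i < n < p]: the
    variable [n] disappears and [i] takes its place in the connector. *)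
Lemma sum_prefix_connector (F : fieldType) p m b (q : nat -> F) :
  p \in [pchar F] -> (b.+1 < p)%N ->
  b.+1%:R^-1 * (\sum_(n < p) (\sum_(i < n) q i) * connector F m n b.+1) =
    - \sum_(l < m.+1) b.+1%:R ^- l.+1 * \sum_(i < p) q i * connector F (m - l) i b.
Proof.
move=> chF bp.
have -> : \sum_(n < p) (\sum_(i < n) q i) * connector F m n b.+1 =
    \sum_(i < p) q i * \sum_(i.+1 <= n < p) connector F m n b.+1.
  under eq_bigr => n _ do
    rewrite big_distrl /= (big_ord_widen p (fun i => q i * connector F m n b.+1))
      ?(ltnW (ltn_ord n)) //.
  rewrite (exchange_big_dep predT) //=; apply: eq_bigr => i _.
  by rewrite big_distrr /= big_geq_mkord.
under eq_bigr => i _ do rewrite (sum_connector _ _ _ _ _ chF) // mulrN big_distrr /=.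
rewrite sumrN mulrN exchange_big /= big_distrr /=; congr (- _).
apply: eq_bigr => l _; rewrite !big_distrr /=; apply: eq_bigr => i _.
by rewrite exprS invfM -!mulrA; congr (_ * _); rewrite mulrCA.
Qed.

(* The summand of the outermost sum in zeta_{<N}(k); for empty k, the convention
   n_0 = 0. *)
Definition summand (F : fieldType) (k : idx) (n : nat) : F :=
  if rev k is a :: s then n%:R ^- val a * zetaF F (rev s) n else (n == 0%N)%:R.

Lemma summand_rcons (F : fieldType) k a n :
  summand F (rcons k a) n = n%:R ^- val a * zetaF F k n.
Proof. by rewrite /summand rev_rcons revK. Qed.

Lemma sum_summand (F : fieldType) k n :
  (0 < n)%N -> \sum_(i < n) summand F k i = zetaF F k n.
Proof.
case/lastP: k => [|k a] n0.
  case: n n0 => // n _; rewrite big_ord_recl /= big1 ?addr0 // /zetaF //.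
by rewrite zetaF_rcons; apply: eq_bigr => i _; rewrite summand_rcons.
Qed.

(** Transports one entry [j.+1], the preceding ones being settled by hypothesis. [connector_mulV]
    turns each surplus factor [1 / n] into a weak letter; the last factor yields the strict head of
    the block. *)
Lemma transport_tail (F : fieldType) p M k : p \in [pchar F] ->
  (forall m B, (m <= M)%N -> (B < p)%N ->
    \sum_(n < p) summand F k n * connector F m n B =
      (-1) ^+ size k * blocksum F M (size k) m k B.+1) ->
  forall j m B, (m <= M)%N -> (B < p)%N ->
    \sum_(n < p) n%:R ^- j.+1 * zetaF F k n * connector F m n B =
      (-1) ^+ (size k).+1 * tailsum F M (size k) m k j B.+1.
Proof.
move=> chF IHk; elim=> [|j IHj] m B mM Bp.
  rewrite tailsum0 //.
  transitivity (\sum_(b < B.+1)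
      b%:R^-1 * \sum_(n < p) (\sum_(i < n) summand F k i) * connector F m n b).
    under [RHS]eq_bigr => b _ do rewrite big_distrr /=.
    rewrite exchange_big; apply: eq_bigr => -[[|n] np] _ /=.
      rewrite expr0n invr0 !mul0r big1 // => b _.
      by rewrite big_ord0 mul0r mulr0.
    rewrite sum_summand // expr1 mulrAC.
    rewrite [_ * connector _ _ _ _](connector_mulV _ _ _ _ _ chF) //.
    by rewrite big_distrl /=; apply: eq_bigr => b _; ring.
  rewrite big_distrr /=; apply: eq_bigr => -[[|b] bB] _ /=.
    rewrite invr0 mul0r big1 ?mulr0 // => l _.
    by rewrite expr0n invr0 mul0r.
  rewrite (sum_prefix_connector _ _ _ _ _ chF) ?(leq_ltn_trans _ Bp) //.
  rewrite exprS mulN1r mulNr; congr (- _); rewrite big_distrr /=.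
  apply: eq_bigr => l _; rewrite IHk ?(leq_trans (leq_subr _ _)) //.
    by rewrite mulrCA.
  by apply: leq_ltn_trans Bp; apply: ltnW.
rewrite tailsumS big_distrr /=.
under [RHS]eq_bigr => b _ do
  rewrite mulrCA -IHj // ?(leq_ltn_trans _ Bp) -1?ltnS // big_distrr /=.
rewrite exchange_big /=; apply: eq_bigr => -[[|n] np] _ /=.
  rewrite expr0n invr0 !mul0r big1 // => b _.
  by rewrite expr0n invr0 !mul0r mulr0.
rewrite (exprSr _ j.+1) invfM -!mulrA [X in _ * X]mulrCA.
rewrite (connector_mulV _ _ _ _ _ chF) // !big_distrr /=.
by apply: eq_bigr => b _; rewrite [RHS]mulrCA -mulrA [X in _ * X]mulrCA.
Qed.

Lemma transport (F : fieldType) p M k m B : p \in [pchar F] ->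
  (m <= M)%N -> (B < p)%N ->
  \sum_(n < p) summand F k n * connector F m n B =
    (-1) ^+ size k * blocksum F M (size k) m k B.+1.
Proof.
move=> chF; elim/last_ind: k m B => [|k a IHk] m B mM Bp.
  rewrite mul1r; case: p chF Bp => // p chF Bp.
  (* For empty [k] only [n = 0] contributes, with [C_m(0, B) = S_m(0)]: 1 for [m = 0] and 0
     otherwise, like the sum over the empty tuple. *)
  rewrite big_ord_recl big1 => [|i _]; last by rewrite mul0r.
  rewrite mul1r addr0 /connector bin0 !mul1r /blocksum.
  case: m mM => [|m] mM.
    rewrite (big_pred1 [tuple]) // => t.
    by rewrite [t]tuple0 /=; apply/esym/eqP/val_inj.
  rewrite hsum1S0 big1 // => t.
  by rewrite [t]tuple0.
rewrite size_rcons blocksum_rcons // -(transport_tail _ _ _ _ chF) //.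
  apply: eq_bigr => n _; rewrite summand_rcons.
  by case: a => -[|a].
Qed.

(** * Coarsenings and weak inequalities *)

(* A flag on a letter is a bar that forbids merging it with the previous one. *)
Fixpoint bar_merges (x : posnat) (w : seq (bool * posnat)) : seq idx :=
  if w is (st, y) :: w' then
    [seq x :: h | h <- bar_merges y w'] ++
    (if st then [::] else bar_merges (addpos (val x) y) w')
  else [:: [:: x]].

(** The coarsest element of [bar_merges x w]: every permitted merge is made. *)
Fixpoint bar_full (x : posnat) (w : seq (bool * posnat)) : idx :=
  if w is (st, y) :: w' then
    if st then x :: bar_full y w' else bar_full (addpos (val x) y) w'
  else [:: x].

Definition addhead (n : nat) (h : idx) : idx :=
  if h is y :: h' then addpos n y :: h' else [::].

Lemma addposA n x y : addpos (val (addpos n x)) y = addpos n (addpos (val x) y).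
Proof. by apply: val_inj; rewrite /= addnA. Qed.

Lemma addhead_inj n : injective (addhead n).
Proof.
move=> [|x s] [|y t] //= [/eqP]; rewrite eqn_add2l => /eqP xy ->.
by congr (_ :: _); apply: val_inj.
Qed.

Lemma merges_addpos n x s : merges (addpos n x) s = map (addhead n) (merges x s).
Proof.
elim: s x => //= y s IH x; rewrite map_cat -map_comp -IH addposA.
by congr (_ ++ _).
Qed.

Lemma bar_full_addpos n x w : bar_full (addpos n x) w = addhead n (bar_full x w).
Proof. by elim: w x => //= -[[] y] w IH x //=; rewrite addposA IH. Qed.

Lemma merges_head x s h : h \in merges x s ->
  exists y h', h = y :: h' /\ (val x <= val y)%N.
Proof.
elim: s x => [|y s IH] x /=.
  by rewrite inE => /eqP ->; exists x, [::].
rewrite mem_cat => /orP[/mapP[h' _ ->]|/IH[z [h' [-> xz]]]].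
  by exists x, h'.
by exists z, h'; split=> //; apply: leq_trans xz; apply: leq_addr.
Qed.

Lemma bar_full_head x w : exists y h, bar_full x w = y :: h /\ (val x <= val y)%N.
Proof.
elim: w x => [|[[] y] w IH] x /=; first by exists x, [::].
  by exists x, (bar_full y w).
have [z [h [-> xz]]] := IH (addpos (val x) y).
by exists z, h; split=> //; apply: leq_trans xz; apply: leq_addr.
Qed.

Lemma ltn_addpos (x y : posnat) : (val x < val (addpos (val x) y))%N.
Proof. by rewrite /= -[X in (X < _)%N]addn0 ltn_add2l (valP y). Qed.

(** Words of the first branch have head [x], those of the second a larger one, as entries are
    positive. So the [undup] in [coarsenings] removes nothing. *)
Lemma merges_uniq x s : uniq (merges x s).
Proof.
elim: s x => //= y s IH x; rewrite cat_uniq !IH map_inj_uniq => [|h h' [] //].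
rewrite IH andbT /=; apply/hasPn => h /merges_head[z [h' [-> xz]]].
apply/mapP => -[h'' _ [zx _]].
by have := leq_trans (ltn_addpos x y) xz; rewrite zx ltnn.
Qed.

Lemma coarsenings_cons x s : coarsenings (x :: s) = merges x s.
Proof. by rewrite /coarsenings undup_id ?merges_uniq. Qed.

Lemma preceq_cons x t h : preceq (x :: t) (x :: h) = preceq t h.
Proof.
rewrite /preceq coarsenings_cons; case: h => [|z h].
  by rewrite /coarsenings /= !inE eqseq_cons eqxx.
rewrite coarsenings_cons /= mem_cat mem_map => [|? ? [] //].
case: (boolP (_ \in merges (addpos _ _) _)); rewrite ?orbF //.
move=> /merges_head[y [h' [[<- _]]]].
by rewrite leqNgt ltn_addpos.
Qed.

Lemma preceq_lt y t z h : (val y < val z)%N -> preceq (y :: t) (z :: h) = false.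
Proof.
move=> yz; rewrite /preceq coarsenings_cons; apply/negP.
by move=> /merges_head[x [h' [[<- _]]]]; rewrite leqNgt yz.
Qed.

Lemma preceq_gt x y t z h : (val x < val y)%N ->
  preceq (y :: t) (x :: z :: h) = preceq (y :: t) (addpos (val x) z :: h).
Proof.
move=> xy; rewrite /preceq !coarsenings_cons /= mem_cat.
case: (boolP (_ \in map _ _)) => //= /mapP[h' _ [yx _]].
by rewrite yx ltnn in xy.
Qed.

Lemma preceq_addhead n t z h :
  preceq (addhead n t) (addpos n z :: h) = preceq t (z :: h).
Proof.
by rewrite /preceq !coarsenings_cons merges_addpos mem_map //; apply: addhead_inj.
Qed.

(** Heads decide. A merge across a bar gives a head larger than that of [bar_full]. Without a bar
    the head of [bar_full] exceeds [x], so the comma after [x] must be merged on the way to it, and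
    [x] cancels. *)
Lemma filter_merges x w :
  [seq h <- merges x (map snd w) | preceq (bar_full x w) h] = bar_merges x w.
Proof.
elim: w x => [|[st y] w IH] x.
  by rewrite /= preceq_cons.
rewrite [merges _ _]/= filter_cat filter_map; case: st; rewrite [bar_full _ _]/=.
  rewrite [bar_merges _ _]/= -IH; congr (_ ++ _).
    by congr map; apply: eq_filter => h /=; rewrite preceq_cons.
  rewrite (eq_in_filter (a2 := pred0)) ?filter_pred0 //.
  move=> h /merges_head[z [h' [-> xz]]] /=; apply: preceq_lt.
  exact: leq_trans (ltn_addpos _ _) xz.
rewrite IH /= -(IH y); congr (map _ _ ++ _).
apply: eq_in_filter => h /merges_head[z [h' [-> _]]] /=.
have [t [s [E xt]]] := bar_full_head (addpos (val x) y) w.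
rewrite E preceq_gt ?(leq_trans (ltn_addpos _ _) xt) // -E bar_full_addpos.
by rewrite preceq_addhead.
Qed.

(** A weak inequality splits into a strict one, which keeps the comma, and an equality, which adds
    the exponents as a plus sign does. *)
Lemma sum_bar_merges (F : fieldType) c x w N :
  \sum_(h <- bar_merges x w) mhs F c (strict h) N = mhs F c ((true, x) :: w) N.
Proof.
elim: w c x => [|[st y] w IH] c x; first by rewrite big_seq1.
have E : \sum_(h <- bar_merges y w) mhs F c (strict (x :: h)) N =
    \sum_(i < N | (c + 1 <= i)%N) i%:R ^- val x * mhs F i ((true, y) :: w) N.
  rewrite exchange_big; apply: eq_bigr => i _.
  by rewrite -big_distrr /= IH.
rewrite [bar_merges _ _]/= big_cat big_map E /=; case: st.
  by rewrite big_nil addr0.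
rewrite IH -big_split; apply: eq_bigr => i _ /=.
rewrite exprD invfM -mulrA -mulrDr; congr (_ * _).
rewrite [RHS](bigD1 i) ?addn0 //= addrC; congr (_ + _); apply: eq_bigl => j.
by rewrite addn1 ltn_neqAle andbC eq_sym.
Qed.

Lemma bar_merges_false x s : bar_merges x (map (pair false) s) = merges x s.
Proof. by elim: s x => //= y s IH x; rewrite !IH. Qed.

Lemma mhs0_head (F : fieldType) x w N :
  mhs F 0 ((true, x) :: w) N = mhs F 0 ((false, x) :: w) N.
Proof.
rewrite /= big_mkcond; apply: eq_bigr => -[[|i] iN] _ //=.
by rewrite expf0N mul0r.
Qed.

(** Without bars all coarsenings occur, so every inequality becomes weak. *)
Lemma sum_star_ones (F : fieldType) m n :
  \sum_(h <- coarsenings (nseq m one_pos)) zetaF F h n.+1 = hsum1 F m n.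
Proof.
case: m => [|m]; first by rewrite big_seq1.
rewrite coarsenings_cons -bar_merges_false sum_bar_merges mhs0_head.
by rewrite map_nseq.
Qed.

Lemma oslash_blocks l k : oslash l k = map snd (blocks l k).
Proof.
rewrite /blocks map_flatten -map_comp /oslash; congr flatten.
by apply: eq_map => q /=; rewrite map_nseq.
Qed.

(** Each block merges completely, into [l + 1 + (k - 1) = l + k], and its strict head bars further
    merging. The letter [x] is a dummy first letter. *)
Lemma bar_full_blocks x l k : bar_full x (blocks l k) = x :: oplus l k.
Proof.
elim: l x k => [|n l IH] x [|y k] //=; congr (_ :: _).
have H j z : bar_full z (nseq j (false, one_pos) ++ blocks l k) =
    addpos j z :: oplus l k.
  elim: j z => [|j IHj] z /=.
    by rewrite IH; congr (_ :: _); apply: val_inj.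
  by rewrite IHj; congr (_ :: _); apply: val_inj; rewrite /= addn1 addnS.
rewrite H; congr (_ :: _); apply: val_inj => /=.
by rewrite addnCA addn1 prednK //; apply: valP.
Qed.

Lemma sum_interval (F : fieldType) l k N : k <> [::] -> size l = size k ->
  \sum_(h <- coarsenings (oslash l k) | preceq (oplus l k) h) zetaF F h N =
    mhs F 0 (blocks l k) N.
Proof.
case: k => // y k _; case: l => // n l _.
have := bar_full_blocks one_pos (n :: l) (y :: k).
rewrite oslash_blocks [blocks _ _]/= => -[<-].
by rewrite coarsenings_cons -big_filter filter_merges sum_bar_merges.
Qed.

(** * The rational sums [zeta_lt] and their reduction in characteristic [p] *)

Lemma sum_tuple_cons (V : zmodType) (T : finType) r (P : pred (seq T))
    (f : seq T -> V) :
  \sum_(t : r.+1.-tuple T | P t) f t =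
    \sum_(x : T) \sum_(t : r.-tuple T | P (x :: t)) f (x :: t).
Proof.
rewrite pair_big_dep /=.
pose h (q : T * r.-tuple T) : r.+1.-tuple T := [tuple of q.1 :: q.2].
rewrite (reindex h) //; apply: onW_bij; apply: inj_card_bij.
  by move=> [x t] [x' t'] /(congr1 val) /= [-> /val_inj ->].
by rewrite card_prod !card_tuple expnS.
Qed.

Lemma mhs_tuple (F : fieldType) c (k : idx) N :
  mhs F c (strict k) N =
    \sum_(t : (size k).-tuple 'I_N | path ltn c (map val t))
      \prod_(q <- zip (map val t) k) q.1%:R ^- val q.2.
Proof.
elim: k c => [|x k IH] c.
  rewrite (big_pred1 [tuple]) => [|t]; first by rewrite big_nil.
  by rewrite [t]tuple0 /=; apply/esym/eqP/val_inj.
rewrite /= (sum_tuple_cons _ _ _ (fun t => path ltn c (map val t))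
  (fun t => \prod_(q <- zip (map val t) (x :: k)) q.1%:R ^- val q.2)).
rewrite big_mkcond; apply: eq_bigr => i _ /=; rewrite addn1.
case: ifP => ci; last by rewrite big_pred0 // => t; rewrite ci.
by rewrite IH big_distrr; apply: eq_big => [t|t _]; rewrite ?ci // big_cons.
Qed.

Lemma zeta_lt_zetaF N k : zeta_lt N k = zetaF rat k N.
Proof.
rewrite /zetaF mhs_tuple; apply: eq_bigr => t _.
rewrite (big_nth (0%N, one_pos)) size_zip size_map size_tuple minnn big_mkord.
apply: eq_bigr => i _.
rewrite nth_zip ?size_map ?size_tuple //= (tnth_nth one_pos).
by rewrite -(tnth_map val) (tnth_nth 0%N).
Qed.

(** Any fraction [a / b] with [b] invertible in [F] is accepted, so sums and products need not be
    put in lowest terms. *)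
Definition reduces (F : fieldType) (r : rat) (y : F) : Prop :=
  exists a b : int, [/\ b%:~R != 0 :> F, r * b%:~R = a%:~R & y * b%:~R = a%:~R].

Lemma reducesD (F : fieldType) r s (y z : F) :
  reduces F r y -> reduces F s z -> reduces F (r + s) (y + z).
Proof.
move=> [a [b [b0 rb yb]]] [c [d [d0 sd zd]]].
exists (a * d + c * b), (b * d); rewrite !intrD !intrM mulf_neq0 //.
by rewrite -rb -sd -yb -zd; split=> //; ring.
Qed.

Lemma reducesM (F : fieldType) r s (y z : F) :
  reduces F r y -> reduces F s z -> reduces F (r * s) (y * z).
Proof.
move=> [a [b [b0 rb yb]]] [c [d [d0 sd zd]]].
exists (a * c), (b * d); rewrite !intrM mulf_neq0 //.
by rewrite -rb -sd -yb -zd; split=> //; ring.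
Qed.

Lemma reduces_int (F : fieldType) (n : nat) : reduces F n%:R n%:R.
Proof. by exists n%:Z, 1; rewrite !mulr1 oner_neq0. Qed.

Lemma reduces_invX (F : fieldType) (n e : nat) : n%:R != 0 :> F ->
  reduces F (n%:R ^- e) (n%:R ^- e).
Proof.
move=> n0; exists 1, (n ^ e)%:Z; rewrite -!pmulrn natrX expf_neq0 //.
rewrite !natrX !mulVf // expf_neq0 // Num.Theory.pnatr_eq0.
by apply: contraNneq n0 => ->.
Qed.

(** All variables are below [N <= p], so the nonzero ones are invertible in [F]; the value 0
    contributes 0 on both sides. *)
Lemma reduces_mhs (F : fieldType) p c w N : p \in [pchar F] -> (N <= p)%N ->
  reduces F (mhs rat c w N) (mhs F c w N).
Proof.
move=> chF Np; elim: w c => [|[st e] w IH] c /=; first exact: (reduces_int F 1).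
apply: (big_ind2 (reduces F)) => [||i _]; first exact: (reduces_int F 0).
  by move=> r y s z; apply: reducesD.
apply: reducesM => //; case: i => -[|i] iN /=.
  by rewrite !expf0N; apply: (reduces_int F 0).
by apply: reduces_invX; apply: natF_neq0 chF _; apply: leq_trans Np.
Qed.

(** The reduced denominator divides [b], hence does not vanish in [F]. *)
Lemma ratr_reduces (F : fieldType) r (y : F) : reduces F r y -> ratr r = y.
Proof.
move=> [a [b [b0 rb yb]]].
suff d0 : (denq r)%:~R != 0 :> F.
  by rewrite (ratr_frac rb) // -yb mulfK.
have : (denq r %| b)%Z.
  rewrite -(Gauss_dvdzr _ (_ : coprimez (denq r) (numq r))); last first.
    by rewrite coprimez_sym /coprimez /gcdz; have := coprime_num_den r => /eqP ->.
  apply/dvdzP; exists a; apply: (@intr_inj rat).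
  by rewrite !intrM -rb numqE mulrAC.
case/dvdzP=> c bE; apply: contraNneq b0 => d0.
by rewrite bE intrM d0 mulr0.
Qed.

(** * Evaluation of formal sums and stuffle products *)

Lemma fglift_sum (V : lmodType rat) (f : idx -> V) (L : seq idx) :
  fglift f (\sum_(h <- L) of_idx h) = \sum_(h <- L) f h.
Proof.
have fB := lift_is_additive f.
have f0 : fglift f 0 = 0 by rewrite -(subrr 0) fB subrr.
have fD u v : fglift f (u + v) = fglift f u + fglift f v.
  have fN : fglift f (- v) = - fglift f v by rewrite -(sub0r v) fB f0 sub0r.
  by rewrite -{1}(opprK v) fB fN opprK.
elim: L => [|h L IH]; first by rewrite !big_nil.
by rewrite !big_cons fD IH liftU scale1r.
Qed.

(* [u] has non-negative integer coefficients and evaluates to [f]: over 'F_p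
   only such combinations of indices can be evaluated directly. *)
Definition realizes (u : calR) (f : forall F : fieldType, nat -> F) : Prop :=
  exists2 L : seq idx, u = \sum_(h <- L) of_idx h &
    forall F N, \sum_(h <- L) zetaF F h N = f F N.

Lemma realizes_ext u f g : (forall F N, f F N = g F N) ->
  realizes u f -> realizes u g.
Proof. by move=> fg [L uL fL]; exists L => // F N; rewrite fL fg. Qed.

Lemma realizes_of_idx k : realizes (of_idx k) (zetaF^~ k).
Proof. by exists [:: k] => [|F N]; rewrite big_seq1. Qed.

Lemma realizesD u v f g : realizes u f -> realizes v g ->
  realizes (u + v) (fun F N => f F N + g F N).
Proof.
move=> [L uL fL] [M vM gM]; exists (L ++ M) => [|F N].
  by rewrite big_cat uL vM.
by rewrite big_cat /= fL gM.
Qed.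

Lemma realizes_sum (I : eqType) (s : seq I) u f :
  (forall i, i \in s -> realizes (u i) (f i)) ->
  realizes (\sum_(i <- s) u i) (fun F N => \sum_(i <- s) f i F N).
Proof.
elim: s => [|i s IH] uf.
  by exists [::] => [|F N]; rewrite !big_nil.
rewrite big_cons; apply: realizes_ext (realizesD _ _ _ _ (uf i _) (IH _)).
- by move=> F N; rewrite big_cons.
- exact: mem_head.
- by move=> j js; apply: uf; rewrite inE js orbT.
Qed.

Lemma realizes_append u f a : realizes u f ->
  realizes (append u a) (fun F N => \sum_(n < N) n%:R ^- val a * f F n).
Proof.
move=> [L uL fL]; exists [seq rcons h a | h <- L] => [|F N].
  by rewrite uL /append fglift_sum big_map.
rewrite big_map; under eq_bigr => h _ do rewrite zetaF_rcons.
by rewrite exchange_big; apply: eq_bigr => n _; rewrite -big_distrr fL.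
Qed.

(** The larger of the two variables belongs to [x] or to [y], or they coincide: these are the three
    terms of the stuffle recursion. *)
Lemma sum_mul_split (F : fieldType) (x y : nat -> F) N :
  (\sum_(n < N) x n) * (\sum_(n < N) y n) =
    \sum_(n < N) x n * (\sum_(i < n) y i) + \sum_(n < N) y n * (\sum_(i < n) x i)
    + \sum_(n < N) x n * y n.
Proof.
elim: N => [|N IH]; first by rewrite !big_ord0 mul0r !addr0.
by rewrite !big_ord_recr /= mulrDl !mulrDr IH; ring.
Qed.

Lemma realizes_stuffle k l :
  realizes (stuffle k l) (fun F N => zetaF F k N * zetaF F l N).
Proof.
elim/last_ind: k l => [|k a IHk] l.
  rewrite stuffle0l; apply: realizes_ext (realizes_of_idx l) => F N.
  by rewrite mul1r.
elim/last_ind: l => [|l b IHl].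
  rewrite stuffle0r; apply: realizes_ext (realizes_of_idx _) => F N.
  by rewrite mulr1.
rewrite stuffle_rcons.
apply: realizes_ext (realizesD _ _ _ _ (realizesD _ _ _ _
  (realizes_append _ _ a (IHk (rcons l b))) (realizes_append _ _ b IHl))
  (realizes_append _ _ (addpos (val a) b) (IHk l))) => F N.
rewrite !zetaF_rcons (sum_mul_split _ (fun n => n%:R ^- val a * zetaF F k n)
  (fun n => n%:R ^- val b * zetaF F l n)).
congr (_ + _ + _); apply: eq_bigr => n _.
- by rewrite zetaF_rcons; ring.
- by rewrite zetaF_rcons; ring.
- by rewrite exprD invfM; ring.
Qed.

(** The two terms of [ustuffle_idx] combine because, for [l = (l_-, b)], the sums [zeta_{<n}(l)] and
    [n^-b zeta_{<n}(l_-)] add up to [zeta_{<n+1}(l)]. *)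
Lemma realizes_ustuffle k a l : l <> [::] ->
  realizes (ustuffle_idx (rcons k a) l)
    (fun F N => \sum_(n < N) n%:R ^- val a * zetaF F k n * zetaF F l n.+1).
Proof.
case/lastP: l => // l b _; rewrite ustuffle_idx_rcons.
apply: realizes_ext (realizesD _ _ _ _
  (realizes_append _ _ a (realizes_stuffle k (rcons l b)))
  (realizes_append _ _ (addpos (val a) b) (realizes_stuffle k l))) => F N.
rewrite -big_split; apply: eq_bigr => n _ /=.
by rewrite !zetaF_rcons big_ord_recr /= exprD invfM; ring.
Qed.

(** * Passage from the single primes to [calA] *)

Lemma toA0 : toA 0 = 0.
Proof. by apply: (addrI (toA 0)); rewrite -toAD !addr0. Qed.

Lemma toA_sum (I : Type) (s : seq I) (P : pred I) (f : I -> prodFp) :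
  toA (\sum_(i <- s | P i) f i) = \sum_(i <- s | P i) toA (f i).
Proof. exact: (big_morph toA toAD toA0). Qed.

Lemma toA_sign n (x : prodFp) : toA ((-1) ^+ n * x) = (-1) ^+ n * toA x.
Proof.
have toAN y : toA (- y) = - toA y.
  by apply/eqP; rewrite -addr_eq0 -toAD addNr toA0.
elim: n => [|n IH]; first by rewrite !mul1r.
by rewrite !exprS -!mulrA !mulN1r toAN IH.
Qed.

Lemma prodFp_sumE (I : Type) (s : seq I) (P : pred I) (f : I -> prodFp) p :
  (\sum_(i <- s | P i) f i) p = \sum_(i <- s | P i) f i p.
Proof.
elim: s => [|i s IH]; first by rewrite !big_nil.
by rewrite !big_cons -IH; case: (P i).
Qed.

Lemma prodFp_signE n (x : prodFp) p : ((-1) ^+ n * x) p = (-1) ^+ n * x p.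
Proof.
elim: n => [|n IH]; first by rewrite !mul1r.
by rewrite !exprS -!mulrA !mulN1r prodFpNE IH.
Qed.

Lemma zeta_A_idxE k : zeta_A_idx k = toA (fun p => zetaF _ k (val p)).
Proof.
congr toA; apply: prodFpP => p; rewrite zeta_lt_zetaF.
by apply: ratr_reduces; apply: reduces_mhs (pchar_Fp (valP p)) _.
Qed.

Lemma zeta_A_realizes u f : realizes u f -> zeta_A u = toA (fun p => f _ (val p)).
Proof.
move=> [L -> fL]; rewrite /zeta_A fglift_sum.
under eq_bigr => h _ do rewrite zeta_A_idxE.
rewrite -toA_sum; congr toA; apply: prodFpP => p.
by rewrite prodFp_sumE fL.
Qed.

Lemma zeta_A_lhs k a m :
  (if m is 0 then zeta_A (of_idx (rcons k a))
   else zeta_A (ustuffle (of_idx (rcons k a)) (star (nseq m one_pos)))) =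
  toA (fun p => \sum_(n < val p) n%:R ^- val a * zetaF _ k n * hsum1 _ m n).
Proof.
case: m => [|m].
  rewrite zeta_A_of_idx zeta_A_idxE; congr toA; apply: prodFpP => p.
  by rewrite zetaF_rcons; apply: eq_bigr => n _; rewrite /hsum1 mulr1.
rewrite /ustuffle /star {1}/of_idx liftU scale1r fglift_sum.
pose f h (F : fieldType) N := \sum_(n < N) n%:R ^- val a * zetaF F k n * zetaF F h n.+1.
rewrite (zeta_A_realizes _ _ (realizes_sum _ _ _ f _)).
  congr toA; apply: prodFpP => p; rewrite /f exchange_big.
  by apply: eq_bigr => n _; rewrite -big_distrr sum_star_ones.
move=> h; rewrite coarsenings_cons => /merges_head[x [h' [-> _]]].
exact: realizes_ustuffle.
Qed.

(* A tuple of non-negative integers of weight m has all its entries at most m. *)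
Theorem theorem5p3 (k : idx) (m : nat) (hk : k <> [::]) :
  (if m is 0 then zeta_A (of_idx k)
   else zeta_A (ustuffle (of_idx k) (star (nseq m one_pos))))
  = (-1) ^+ dep k *
    \sum_(l : (dep k).-tuple 'I_m.+1 | sumn (map val l) == m)
      \sum_(h <- coarsenings (oslash (map val l) k)
             | preceq (oplus (map val l) k) h)
        zeta_A (of_idx h).
Proof.
under eq_bigr => l _ do under eq_bigr => h _ do rewrite zeta_A_of_idx zeta_A_idxE.
under eq_bigr => l _ do rewrite -toA_sum.
rewrite -toA_sum -toA_sign.
case/lastP: k hk => // k a _; rewrite zeta_A_lhs; congr toA; apply: prodFpP => p.
rewrite prodFp_signE prodFp_sumE.
have chF := pchar_Fp (valP p); have p_gt0 := prime_gt0 (valP p).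
(* With [B = p - 1] the connector equals [S_m(n)] and the bound [B.+1] on the right is [p]; [M = m]
   matches the tuples of the statement. *)
have := transport _ _ m (rcons k a) m (val p).-1 chF (leqnn m).
rewrite prednK // leqnn => /(_ isT) E.
transitivity (\sum_(n < val p) summand 'F_(val p) (rcons k a) n *
    connector 'F_(val p) m n (val p).-1).
  by apply: eq_bigr => n _; rewrite summand_rcons (connector_top _ _ _ _ chF).
rewrite E; congr (_ * _); apply: eq_bigr => l _.
rewrite prodFp_sumE sum_interval //; first by case: (k).
by rewrite size_map size_tuple.
Qed.
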